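(* Let $0<\beta<1$. Consider the problem: among all pairs $(p,u)$ with $p>0$ and $u\in W^{1,1}[-p,p]$ nonnegative, satisfying $u(p)=u(-p)=0$ and $\int_{-p}^p u\,dx=1$, minimize $$J[u]=\int_{-p}^p\Big[\sqrt{1+u'(x)^2}-\beta\Big]\,dx.$$ Then there exists a unique minimizer, it is smooth up to the boundary of $[-p,p]$, and it is given by $$u(x)=\sqrt{R^2-x^2}-\beta R,\qquad R^{-1}=\sqrt{\arccos\beta-\beta\sqrt{1-\beta^2}},\qquad p=\sqrt{1-\beta^2}\,R.$$ Furthermore, the graph of $u$ meets the $x$-axis at $\pm p$ with interior angle $\arccos\beta$, i.e. $\frac{1}{\sqrt{1+u'(\pm p)^2}}=\beta$.
   Context: $W^{1,1}[-p,p]$ denotes the Sobolev space of integrable functions on $[-p,p]$ with integrable weak derivative (absolutely continuous functions). The half-width $p>0$ is free (part of the minimization). *)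

(* Defs.v *)
From HB Require Import structures.
From mathcomp Require Import all_boot all_order all_algebra.
From mathcomp Require Import all_classical all_reals all_analysis.
Set Implicit Arguments. Unset Strict Implicit. Unset Printing Implicit Defensive.
Import Order.TTheory GRing.Theory Num.Theory.
Import numFieldNormedType.Exports.
Local Open Scope classical_set_scope.
Local Open Scope ring_scope.

(* W^{1,1}[-p,p]: u is absolutely continuous on [-p,p] with weak derivative g,
   i.e. g is Lebesgue integrable on [-p,p] and u(x) = u(-p) + int_{-p}^x g
   for every x in [-p,p]. *)
Definition W11 {R : realType} (p : R) (u g : R -> R) : Prop :=
  (@lebesgue_measure R).-integrable `[-p, p] (EFin \o g) /\
  forall x, -p <= x <= p ->
    u x = u (-p) + Rintegral (@lebesgue_measure R) `[-p, x] g.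

Definition admissible {R : realType} (p : R) (u g : R -> R) : Prop :=
  0 < p /\ W11 p u g /\
  (forall x, -p <= x <= p -> 0 <= u x) /\
  u p = 0 /\ u (-p) = 0 /\
  (\int[@lebesgue_measure R]_(x in `[(- p)%R, p]) (u x)%:E = 1%:E)%E.

Definition Jfun {R : realType} (beta p : R) (g : R -> R) : \bar R :=
  (\int[@lebesgue_measure R]_(x in `[(- p)%R, p]) (Num.sqrt (1 + g x ^+ 2) - beta)%R%:E)%E.

Definition minimizer {R : realType} (beta p : R) (u : R -> R) : Prop :=
  exists g, admissible p u g /\
    forall q v h, admissible q v h -> (Jfun beta p g <= Jfun beta q h)%E.

(* Main.v *)
Require Import Defs.
From HB Require Import structures.
From mathcomp Require Import all_boot all_order all_algebra.
From mathcomp Require Import all_classical all_reals all_analysis.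
From mathcomp Require Import measurable_realfun ring lra.
Import Order.TTheory GRing.Theory Num.Theory.
Import numFieldNormedType.Exports.
Local Open Scope classical_set_scope.
Local Open Scope ring_scope.
Set Implicit Arguments. Unset Strict Implicit. Unset Printing Implicit Defensive.

(** A calibration argument.  Put [s = sqrt (1 - beta ^ 2)].  Compare a
competitor [v] on [[- s r, s r]] having derivative [h] with the arc of the
circle of radius [r] that meets this chord at the angle [acos beta].  By
Cauchy-Schwarz, [sqrt (1 + h ^ 2) >= (sqrt (r ^ 2 - x ^ 2) - x h) / r], with
equality iff [h] is the slope of the circle.  Integration by parts gives
[int x h = - int v = - 1], hence, with [A = acos beta - beta s],
[J >= r A + 1 / r >= 2 sqrt A], where the last step is AM-GM.  Both
inequalities are equalities exactly when [r = 1 / sqrt A] and [h] is almost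
everywhere the slope of the circle. *)

(** * Integration *)

Section integrable_EFin.
Context d (T : measurableType d) (R : realType).
Variables (mu : {measure set T -> \bar R}) (D : set T).
Hypothesis mD : measurable D.
Implicit Types f g : T -> R.

Lemma integrable_EFinZl k f : mu.-integrable D (EFin \o f) ->
  mu.-integrable D (EFin \o (fun x => k * f x)).
Proof. by move=> fi; have := integrableZl mD k fi; apply. Qed.

Lemma integrable_EFinD f g : mu.-integrable D (EFin \o f) ->
  mu.-integrable D (EFin \o g) ->
  mu.-integrable D (EFin \o (fun x => f x + g x)).
Proof. by move=> fi gi; have := integrableD mD fi gi; apply. Qed.

Lemma integrable_EFinB f g : mu.-integrable D (EFin \o f) ->
  mu.-integrable D (EFin \o g) ->
  mu.-integrable D (EFin \o (fun x => f x - g x)).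
Proof. by move=> fi gi; have := integrableB mD fi gi; apply. Qed.

Lemma EFin_Rintegral f : mu.-integrable D (EFin \o f) ->
  (\int[mu]_(x in D) f x)%:E = (\int[mu]_(x in D) (f x)%:E)%E.
Proof. by move=> fi; rewrite /Rintegral fineK// integrable_fin_num. Qed.

Lemma EFin_mulr_Rintegral k f : mu.-integrable D (EFin \o f) ->
  (k * \int[mu]_(x in D) f x)%:E = (\int[mu]_x (k * (f \_ D) x)%:E)%E.
Proof.
move=> fi; rewrite -RintegralZl// EFin_Rintegral; last exact: integrable_EFinZl.
rewrite integral_mkcond; apply: eq_integral => x _.
by rewrite !patchE; case: ifP => // _; rewrite mulr0.
Qed.

Lemma ge0_Rintegral_eq0_ae f : mu.-integrable D (EFin \o f) ->
  (forall x, D x -> 0 <= f x) -> \int[mu]_(x in D) f x = 0 ->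
  ae_eq mu D f (cst 0).
Proof.
move=> fi f0 If0.
have : ae_eq mu D (EFin \o f) (cst 0%E).
  apply/ae_eq_integral_abs => //; first exact: measurable_int fi.
  rewrite -[RHS]/(0%:E) -If0 EFin_Rintegral//; apply: eq_integral => x.
  by rewrite inE => Dx; rewrite gee0_abs// lee_fin f0.
by apply: filterS => x fx0 Dx; apply: EFin_inj; exact: fx0.
Qed.

End integrable_EFin.

Lemma integrable_prod_mul d1 d2 (T1 : measurableType d1)
    (T2 : measurableType d2) (R : realType)
    (m1 : {sigma_finite_measure set T1 -> \bar R})
    (m2 : {sigma_finite_measure set T2 -> \bar R})
    (f : T1 -> R) (g : T2 -> R) :
  m1.-integrable setT (EFin \o f) -> m2.-integrable setT (EFin \o g) ->
  (m1 \x m2)%E.-integrable setT (EFin \o (fun z => f z.1 * g z.2)).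
Proof.
move=> fi gi; have [/integrableP[+ f_fin] /integrableP[+ g_fin]] := (fi, gi).
move=> /measurable_EFinP mf /measurable_EFinP mg.
apply/integrable12ltyP.
  by apply/measurable_EFinP; apply: measurable_funM; exact: measurableT_comp.
have -> : (\int[m1]_x \int[m2]_y `|(f x * g y)%:E| =
    \int[m1]_x (`|(f x)%:E| * \int[m2]_y `|(g y)%:E|))%E.
  apply: eq_integral => x _; rewrite -ge0_integralZl//.
    by apply: eq_integral => y _; rewrite EFinM abseM.
  by apply: measurableT_comp => //; exact/measurable_EFinP.
rewrite ge0_integralZr ?integral_ge0//; last first.
  by apply: measurableT_comp => //; exact/measurable_EFinP.
by rewrite lte_mul_pinfty ?ge0_fin_numE ?integral_ge0.
Qed.

Section real_interval.
Variable R : realType.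
Local Notation mu := (@lebesgue_measure R).
Implicit Types (a b k x : R) (f g F : R -> R).

Lemma itv_sqr_le a x : x \in `[- a, a] -> x ^+ 2 <= a ^+ 2.
Proof. by rewrite in_itv/= => /andP[? ?]; nra. Qed.

Lemma integrable_lower_triangle f g :
  mu.-integrable setT (EFin \o f) -> mu.-integrable setT (EFin \o g) ->
  (mu \x mu)%E.-integrable setT
    (EFin \o (fun z => (z.2 <= z.1)%R%:R * (f z.1 * g z.2))).
Proof.
move=> fi gi; have fgi := integrable_prod_mul fi gi.
apply: (le_integrable _ _ _ fgi) => //=; last first.
  move=> z _; rewrite lee_fin; case: (z.2 <= z.1); rewrite ?mul1r//.
  by rewrite mul0r normr0.
apply/measurable_EFinP/measurable_funM.
  apply: (measurableT_comp (f := fun c : bool => c%:R : R)) => //.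
  exact: measurable_fun_ler.
by apply/measurable_EFinP; exact: measurable_int fgi.
Qed.

Lemma Rintegral_triangle a b f g :
  mu.-integrable `[a, b] (EFin \o f) -> mu.-integrable `[a, b] (EFin \o g) ->
  \int[mu]_(x in `[a, b]) (f x * \int[mu]_(y in `[a, x]) g y) =
  \int[mu]_(y in `[a, b]) (g y * \int[mu]_(x in `[y, b]) f x).
Proof.
move=> fi gi; pose fab := f \_ `[a, b]; pose gab := g \_ `[a, b].
have restrict_int h : mu.-integrable `[a, b] (EFin \o h) ->
    mu.-integrable setT (EFin \o (h \_ `[a, b])).
  move=> hi; rewrite -restrict_EFin.
  by apply/integrable_restrict; rewrite ?setTI.
have ki := integrable_lower_triangle (restrict_int _ fi) (restrict_int _ gi).
congr fine; rewrite integral_mkcond [RHS]integral_mkcond.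
transitivity (\int[mu]_x \int[mu]_y ((y <= x)%R%:R * (fab x * gab y))%:E)%E.
  apply: eq_integral => x _; rewrite patchE; case: ifPn => [|xab]; last first.
    rewrite integral0_eq// => y _.
    by rewrite /fab patchE (negbTE xab) mul0r mulr0.
  rewrite inE/= in_itv/= => /andP[ax xb].
  rewrite EFin_mulr_Rintegral//; last first.
    by apply: integrableS gi => //; apply: subset_itvl; rewrite bnd_simp.
  apply: eq_integral => y _; congr EFin.
  rewrite /fab /gab !patchE !mem_setE !in_itv/= ax xb/=.
  case: (leP y x) => yx; last by rewrite andbF mulr0 mul0r.
  by rewrite (le_trans yx xb) andbT mul1r.
rewrite (Fubini ki); apply: eq_integral => y _.
rewrite [RHS]patchE; case: ifPn => [|yab]; last first.
  rewrite integral0_eq// => x _.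
  by rewrite /= [X in _ * X]mulrC patchE (negbTE yab) mul0r mulr0.
rewrite inE/= in_itv/= => /andP[ay yb].
rewrite EFin_mulr_Rintegral//; last first.
  by apply: integrableS fi => //; apply: subset_itvr; rewrite bnd_simp.
apply: eq_integral => x _; congr EFin.
rewrite /= !patchE !mem_setE !in_itv/= ay yb/=.
case: (leP y x) => yx; last by rewrite mulr0 mul0r.
by rewrite (le_trans ay yx) mul1r mulrC.
Qed.

Lemma continuous_integrable_itv a b f :
  {in `[a, b], continuous f} -> mu.-integrable `[a, b] (EFin \o f).
Proof.
move=> cf; apply: continuous_compact_integrable; first exact: segment_compact.
by apply: continuous_in_subspaceT => x /[!inE]/=; exact: cf.
Qed.

Lemma integrable_itv_cst a b k : mu.-integrable `[a, b] (EFin \o cst k).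
Proof. by apply: continuous_integrable_itv => x _; exact: cst_continuous. Qed.

Lemma Rintegral_itv_cst a b k : a <= b ->
  \int[mu]_(x in `[a, b]) k = k * (b - a).
Proof.
rewrite le_eqVlt => /predU1P[->|ab].
  by rewrite set_itv1 Rintegral_set1 subrr mulr0.
by rewrite Rintegral_cst//= lebesgue_measure_itv/= lte_fin ab.
Qed.

Lemma integrable_itv_mul_id a b f : mu.-integrable `[a, b] (EFin \o f) ->
  mu.-integrable `[a, b] (EFin \o (fun x => x * f x)).
Proof.
move=> fi; have [M [_ abM]] := compact_bounded (@segment_compact R a b).
have := @integrableMr _ _ _ mu `[a, b] (measurable_itv _) id _ _ _ fi.
by apply=> //; exists M; split; first exact: num_real.
Qed.

Lemma integrable_itv_sqrt1D_sqr a b f : mu.-integrable `[a, b] (EFin \o f) ->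
  mu.-integrable `[a, b] (EFin \o (fun x => Num.sqrt (1 + f x ^+ 2))).
Proof.
move=> fi; have mf : measurable_fun `[a, b] f.
  by apply/measurable_EFinP; exact: measurable_int fi.
have i1 := integrable_itv_cst a b 1.
apply: (le_integrable _ _ _ (integrable_EFinD _ i1 (integrable_norm fi))) => //.
- apply/measurable_EFinP; apply: (measurableT_comp (f := @Num.sqrt R)).
    exact: continuous_measurable_fun (@sqrt_continuous R).
  by apply: measurable_funD => //; exact: measurable_funX.
- move=> x _ /=; rewrite lee_fin [leLHS]ger0_norm ?sqrtr_ge0//.
  rewrite -sqrtr_sqr ler_wsqrtr// -[f x ^+ 2]real_normK ?num_real//.
  by have := normr_ge0 (f x); nra.
Qed.

Lemma Rintegral_FTC2 a b f F : a <= b -> {in `[a, b], continuous f} ->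
  {in `[a, b], forall x, is_derive x 1 F (f x)} ->
  \int[mu]_(x in `[a, b]) f x = F b - F a.
Proof.
rewrite le_eqVlt => /predU1P[<-|ab] cf dF.
  by rewrite set_itv1 Rintegral_set1 subrr.
have cF x : x \in `[a, b] -> {for x, continuous F}.
  move=> xab; apply/differentiable_continuous/derivable1_diffP.
  by have [] := dF _ xab.
rewrite /Rintegral (@continuous_FTC2 _ f F)//.
- by apply: continuous_in_subspaceT => x /[!inE]/=; exact: cf.
- split; first by move=> x /subset_itv_oo_cc /dF [].
  + by apply/cvg_at_right_filter/cF; rewrite in_itv/= lexx ltW.
  + by apply/cvg_at_left_filter/cF; rewrite in_itv/= lexx ltW.
- by move=> x /subset_itv_oo_cc /dF dFx; rewrite derive1E derive_val.
Qed.

End real_interval.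

(** * Absolutely continuous functions *)

Section W11_theory.
Variable R : realType.
Local Notation mu := (@lebesgue_measure R).
Implicit Types (p x : R) (u v g h : R -> R).

Lemma W11_is_derive p u g : {in `[- p, p], continuous g} ->
  {in `[- p, p], forall x, is_derive x 1 u (g x)} -> W11 p u g.
Proof.
move=> cg du; split; first exact: continuous_integrable_itv.
move=> x /andP[px xp].
have sub : {subset `[- p, x] <= `[- p, p]}.
  by move=> y; rewrite !in_itv/= => /andP[-> /le_trans->].
have cgx : {in `[- p, x], continuous g} by move=> y /sub; exact: cg.
have dux : {in `[- p, x], forall y : R, is_derive y 1 u (g y)}.
  by move=> y /sub; exact: du.
by rewrite (Rintegral_FTC2 px cgx dux) addrC subrK.
Qed.

Lemma W11_integrable p u g : 0 <= p -> W11 p u g ->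
  mu.-integrable `[- p, p] (EFin \o u).
Proof.
move=> p0 [gi uE].
have pp : - p <= p by rewrite ge0_cp.
have ci := integrable_itv_cst (- p) p (u (- p)).
have Gi : mu.-integrable `[- p, p]
    (EFin \o (fun x => \int[mu]_(t in `[- p, x]) g t)).
  apply: continuous_compact_integrable; first exact: segment_compact.
  exact: parameterized_integral_continuous.
have : mu.-integrable `[- p, p]
    (EFin \o (fun x => u (- p) + \int[mu]_(t in `[- p, x]) g t)).
  exact: integrable_EFinD.
apply: eq_integrable => // x; rewrite inE/= in_itv/= => xp.
by rewrite /= (uE x).
Qed.

Lemma W11_integration_by_parts p u g : 0 <= p -> W11 p u g ->
  \int[mu]_(x in `[- p, p]) (x * g x) =
  p * (u p + u (- p)) - \int[mu]_(x in `[- p, p]) u x.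
Proof.
move=> p0 W; have [gi uE] := W; have ui := W11_integrable p0 W.
have pp : - p <= p by rewrite ge0_cp.
have ci := integrable_itv_cst (- p) p; have xgi := integrable_itv_mul_id gi.
have pgi : mu.-integrable `[- p, p] (EFin \o (fun x => p * g x)).
  exact: integrable_EFinZl.
have upE : u p = u (- p) + \int[mu]_(x in `[- p, p]) g x.
  by rewrite -uE// pp lexx.
have : \int[mu]_(x in `[- p, p]) (u x - u (- p)) =
       \int[mu]_(x in `[- p, p]) (p * g x - x * g x).
  transitivity (\int[mu]_(x in `[- p, p])
      (cst 1 x * \int[mu]_(t in `[- p, x]) g t)).
    apply: eq_Rintegral => x; rewrite inE/= in_itv/= => xp.
    by rewrite mul1r uE// addrAC subrr add0r.
  rewrite Rintegral_triangle//; apply: eq_Rintegral => x.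
  rewrite inE/= in_itv/= => /andP[_ xp].
  by rewrite Rintegral_itv_cst// mul1r mulrC mulrBl.
rewrite (RintegralB _ ui (ci _)) ?(RintegralB _ pgi xgi)//.
rewrite RintegralZl// Rintegral_itv_cst// upE.
by move: (\int[mu]_(x in _) u x) => U E; nra.
Qed.

Lemma W11_eq_ae p u v g h : W11 p u g -> W11 p v h -> u (- p) = v (- p) ->
  ae_eq mu `[- p, p]%classic g h ->
  {in `[- p, p], u =1 v}.
Proof.
move=> [gi uE] [hi vE] uv gh x; rewrite in_itv/= => /andP[px xp].
have sub : `[- p, x] `<=` `[- p, p] by apply: subset_itvl; rewrite bnd_simp.
rewrite uE ?px// vE ?px// uv; congr (_ + fine _).
apply: ae_eq_integral => //.
- by apply: measurable_int; apply: integrableS gi.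
- by apply: measurable_int; apply: integrableS hi.
- exact: ae_eq_subset (ae_eq_comp EFin gh).
Qed.

End W11_theory.

(** * Circular arcs *)

Section arcsine.
Variable R : realType.
Implicit Type x : R.

Lemma asinN x : -1 <= x <= 1 -> asin (- x) = - asin x.
Proof.
move=> x1; rewrite -[in LHS](asinK (x := x)) ?in_itv//= -sinN sinK//.
by rewrite in_itv/= lerNl opprK lerNl asin_lepi2// asin_geNpi2.
Qed.

Lemma asin_sqrt1B_sqr x : 0 <= x <= 1 -> asin (Num.sqrt (1 - x ^+ 2)) = acos x.
Proof.
move=> /andP[x0 x1]; have x11 : -1 <= x <= 1 by lra.
rewrite -sin_acos// sinK// in_itv/=; apply/andP; split.
  by rewrite (le_trans _ (acos_ge0 x11))// oppr_le0 divr_ge0 ?pi_ge0.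
rewrite leNgt; apply/negP => pix.
have : cos (acos x) < cos (pi / 2).
  rewrite ltr_cos ?in_itv//= ?acos_ge0 ?acos_lepi//.
  by have := pi_ge0 R; lra.
by rewrite acosK ?in_itv//= cos_pihalf ltNge x0.
Qed.

End arcsine.

Section semicircle.
Variables (R : realType) (r : R).
Local Notation mu := (@lebesgue_measure R).
Implicit Types (x t : R).

Definition semicircle x := Num.sqrt (r ^+ 2 - x ^+ 2).

Definition semicircle_slope x := - x / semicircle x.

Lemma semicircle_gt0 x : x ^+ 2 < r ^+ 2 -> 0 < semicircle x.
Proof. by rewrite sqrtr_gt0 subr_gt0. Qed.

Lemma sqr_semicircle x : x ^+ 2 <= r ^+ 2 ->
  semicircle x ^+ 2 = r ^+ 2 - x ^+ 2.
Proof. by move=> xr; rewrite sqr_sqrtr// subr_ge0. Qed.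

Lemma sqrD_semicircle x : x ^+ 2 <= r ^+ 2 ->
  semicircle x ^+ 2 + x ^+ 2 = r ^+ 2.
Proof. by move=> /sqr_semicircle ->; rewrite subrK. Qed.

Lemma semicircleN x : semicircle (- x) = semicircle x.
Proof. by rewrite /semicircle sqrrN. Qed.

Lemma le_semicircle x t : x ^+ 2 <= t ^+ 2 -> semicircle t <= semicircle x.
Proof. by move=> xt; rewrite ler_wsqrtr// lerB. Qed.

Lemma continuous_semicircle : continuous semicircle.
Proof.
move=> x; apply: continuous_comp; last exact: sqrt_continuous.
by apply: cvgB; [exact: cvg_cst|exact: exprn_continuous].
Qed.

Lemma integrable_semicircle a b :
  mu.-integrable `[a, b] (EFin \o semicircle).
Proof.
by apply: continuous_integrable_itv => x _; exact: continuous_semicircle.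
Qed.

Lemma continuous_semicircle_slope x : x ^+ 2 < r ^+ 2 ->
  {for x, continuous semicircle_slope}.
Proof.
move=> xr; apply: (@cvgM _ _ _ _ -%R (fun z => (semicircle z)^-1)).
  exact: opp_continuous.
by apply: cvgV; [rewrite gt_eqF ?semicircle_gt0|exact: continuous_semicircle].
Qed.

Lemma is_derive_semicircle x : x ^+ 2 < r ^+ 2 ->
  is_derive x 1 semicircle (semicircle_slope x).
Proof.
move=> xr; have rx0 : 0 < r ^+ 2 - x ^+ 2 by rewrite subr_gt0.
have dsqrt := is_derive1_sqrt rx0.
have dsub : is_derive x 1 (fun t => r ^+ 2 - t ^+ 2) (- (2 * x)).
  by apply: is_derive_eq; rewrite /GRing.scale /=; ring.
have dcomp := @is_derive1_comp _ Num.sqrt (fun t => r ^+ 2 - t ^+ 2)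
  _ _ _ dsqrt dsub.
apply: (is_derive_eq dcomp).
have := semicircle_gt0 xr; rewrite /semicircle_slope /semicircle => y0.
by rewrite /GRing.scale /=; field; rewrite gt_eqF.
Qed.

Hypothesis r0 : 0 < r.

Lemma is_derive_asin_div x : x ^+ 2 < r ^+ 2 ->
  is_derive x 1 (fun t => asin (t / r)) (semicircle x)^-1.
Proof.
move=> xr; have y0 := semicircle_gt0 xr.
have xr1 : -1 < x / r < 1.
  rewrite ltr_pdivlMr// ltr_pdivrMr//; have r_gt0 := r0.
  by apply/andP; split; nra.
have dasin := is_derive1_asin xr1.
have ddiv : is_derive x 1 (fun t => t / r) r^-1.
  by apply: is_derive_eq; rewrite /GRing.scale /=; ring.
have dcomp := @is_derive1_comp _ (@asin R) (fun t => t / r) _ _ _ dasin ddiv.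
apply: (is_derive_eq dcomp).
have -> : 1 - (x / r) ^+ 2 = (semicircle x / r) ^+ 2.
  by rewrite !expr_div_n sqr_semicircle ?ltW//; field; rewrite gt_eqF.
rewrite sqrtr_sqr ger0_norm ?divr_ge0 ?ltW//.
by rewrite /GRing.scale /=; field; rewrite !gt_eqF.
Qed.

Lemma is_derive_semicircle_primitive x : x ^+ 2 < r ^+ 2 ->
  is_derive x 1 (fun t => (r ^+ 2 * asin (t / r) + t * semicircle t) / 2)
    (semicircle x).
Proof.
move=> xr; have y0 := semicircle_gt0 xr.
have dasin := is_derive_asin_div xr; have dy := is_derive_semicircle xr.
apply: is_derive_eq; rewrite /GRing.scale /= /semicircle_slope.
by rewrite -(sqrD_semicircle (ltW xr)); field; rewrite gt_eqF.
Qed.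

Lemma Rintegral_semicircle p : 0 < p < r ->
  \int[mu]_(x in `[- p, p]) semicircle x =
  r ^+ 2 * asin (p / r) + p * semicircle p.
Proof.
move=> /andP[p0 pr]; have pp : - p <= p by rewrite ge0_cp ?ltW.
have dF : {in `[- p, p], forall x, is_derive x 1
    (fun t => (r ^+ 2 * asin (t / r) + t * semicircle t) / 2) (semicircle x)}.
  move=> x; rewrite in_itv/= => /andP[px xp].
  by apply: is_derive_semicircle_primitive; nra.
rewrite (Rintegral_FTC2 pp (in1W continuous_semicircle) dF).
rewrite mulNr asinN ?semicircleN; first by field.
by rewrite ler_pdivlMr// ler_pdivrMr//; lra.
Qed.

Lemma sqrt1D_sqr_semicircle_slope x : x ^+ 2 < r ^+ 2 ->
  Num.sqrt (1 + semicircle_slope x ^+ 2) = r / semicircle x.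
Proof.
move=> xr; have y0 := semicircle_gt0 xr.
have -> : 1 + semicircle_slope x ^+ 2 = (r / semicircle x) ^+ 2.
  rewrite !expr_div_n -(sqrD_semicircle (ltW xr)).
  by field; rewrite gt_eqF.
by rewrite sqrtr_sqr ger0_norm ?divr_ge0 ?ltW.
Qed.

(* [semicircle x - x * t] is the inner product of [(1, t)] with the radius
   vector, of length [r], that is normal to the circle above [x]: the gap is the
   defect in Cauchy-Schwarz. *)
Definition calibration_gap x t :=
  Num.sqrt (1 + t ^+ 2) - (semicircle x - x * t) / r.

Lemma Lagrange_semicircle x t : x ^+ 2 <= r ^+ 2 ->
  (1 + t ^+ 2) * r ^+ 2 =
  (semicircle x - x * t) ^+ 2 + (x + semicircle x * t) ^+ 2.
Proof. by move=> xr; rewrite -(sqrD_semicircle xr); ring. Qed.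

Lemma calibration_gap_ge0 x t : x ^+ 2 <= r ^+ 2 -> 0 <= calibration_gap x t.
Proof.
move=> xr; rewrite subr_ge0 ler_pdivrMr//; apply: le_trans (ler_norm _) _.
rewrite -ler_sqr ?nnegrE ?mulr_ge0 ?sqrtr_ge0 ?(ltW r0)//.
rewrite real_normK ?num_real// exprMn sqr_sqrtr ?addr_ge0 ?sqr_ge0//.
by rewrite (Lagrange_semicircle _ xr) lerDl sqr_ge0.
Qed.

Lemma calibration_gap_slope x : x ^+ 2 < r ^+ 2 ->
  calibration_gap x (semicircle_slope x) = 0.
Proof.
move=> xr; have y0 := semicircle_gt0 xr.
rewrite /calibration_gap sqrt1D_sqr_semicircle_slope// /semicircle_slope.
transitivity ((r ^+ 2 - (semicircle x ^+ 2 + x ^+ 2)) / (r * semicircle x)).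
  by field; rewrite !gt_eqF.
by rewrite sqrD_semicircle ?subrr ?mul0r ?ltW.
Qed.

Lemma calibration_gap_eq0 x t : x ^+ 2 < r ^+ 2 -> calibration_gap x t = 0 ->
  t = semicircle_slope x.
Proof.
move=> xr /eqP; rewrite subr_eq0 => /eqP tangent.
have y0 := semicircle_gt0 xr.
have t1 : 0 <= 1 + t ^+ 2 by rewrite addr_ge0 ?sqr_ge0.
have /eqP : (x + semicircle x * t) ^+ 2 = 0.
  apply: (addrI ((semicircle x - x * t) ^+ 2)).
  rewrite addr0 -(Lagrange_semicircle _ (ltW xr)).
  by rewrite -(sqr_sqrtr t1) tangent -exprMn divfK ?gt_eqF.
rewrite sqrf_eq0 => /eqP xyt.
by apply: (mulIf (lt0r_neq0 y0)); rewrite divfK ?gt_eqF//; lra.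
Qed.

Lemma integrable_calibration_gap a b h : mu.-integrable `[a, b] (EFin \o h) ->
  mu.-integrable `[a, b] (EFin \o (fun x => calibration_gap x (h x))).
Proof.
move=> hi.
have yxh : mu.-integrable `[a, b] (EFin \o (fun x => semicircle x - x * h x)).
  by apply: integrable_EFinB => //;
    [exact: integrable_semicircle|exact: integrable_itv_mul_id].
have : mu.-integrable `[a, b] (EFin \o
    (fun x => Num.sqrt (1 + h x ^+ 2) - r^-1 * (semicircle x - x * h x))).
  apply: integrable_EFinB => //; first exact: integrable_itv_sqrt1D_sqr.
  exact: integrable_EFinZl.
by apply: eq_integrable => // x _; rewrite /= /calibration_gap mulrC.
Qed.

End semicircle.

Section semicircle_smooth.
Variables (R : realType) (r c : R).
Implicit Types (x : R) (P : {poly R}) (k n : nat).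

Lemma is_derive_horner_semicircle P k x : x ^+ 2 < r ^+ 2 ->
  is_derive x 1 (fun t => P.[t] * (semicircle r t)^-1 ^+ k)
    ((P^`() * ((r ^+ 2)%:P - 'X^2) + k%:R *: ('X * P)).[x] *
     (semicircle r x)^-1 ^+ k.+2).
Proof.
move=> xr; have y0 := semicircle_gt0 xr; have dP := is_derive_poly P x.
have dV := is_deriveV (lt0r_neq0 y0) (is_derive_semicircle xr).
have := is_deriveX k dV; rewrite exprfctE => dVk.
apply: (is_derive_eq (is_deriveM dP dVk)).
rewrite !(hornerD, hornerN, hornerM, hornerC, hornerXn, hornerX, hornerZ).
rewrite /GRing.scale /= /semicircle_slope -(sqr_semicircle (ltW xr)).
case: k {dVk} => [|k]; first by rewrite /=; field; rewrite gt_eqF.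
by rewrite /= -natr1 !exprS; field; rewrite gt_eqF.
Qed.

Lemma near_sqr_lt x (a : R) : x ^+ 2 < a -> \forall z \near x, z ^+ 2 < a.
Proof. by move=> xa; apply: (cvgr_lt _ (@exprn_continuous R 2 x)). Qed.

Lemma derive1n_semicircleB n : exists P k, forall x, x ^+ 2 < r ^+ 2 ->
  derive1n n.+1 (fun t => semicircle r t - c) x =
  P.[x] * (semicircle r x)^-1 ^+ k.
Proof.
elim: n => [|n [P [k IH]]].
  exists (- 'X), 1%N => x xr; rewrite derive1n1 derive1E.
  have dy := is_derive_semicircle xr.
  by rewrite derive_val subr0 !hornerE.
eexists; exists k.+2 => x xr; rewrite derive1nS derive1E.
have /near_eq_is_derive deq := is_derive_horner_semicircle P k xr.
have [|_ ->//] := deq (derive1n n.+1 (fun t => semicircle r t - c)).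
by near=> z; rewrite IH//; near: z; exact: near_sqr_lt.
Unshelve. all: by end_near. Qed.

Lemma derivable_derive1n_semicircleB n x : x ^+ 2 < r ^+ 2 ->
  derivable (derive1n n (fun t => semicircle r t - c)) x 1.
Proof.
move=> xr; case: n => [|n].
  have dy := is_derive_semicircle xr.
  by rewrite derive1n0; apply: derivableB.
have [P [k E]] := derive1n_semicircleB n.
have [+ _] := is_derive_horner_semicircle P k xr.
apply: near_eq_derivable.
by near=> z; rewrite E//; near: z; exact: near_sqr_lt.
Unshelve. all: by end_near. Qed.

End semicircle_smooth.

(** * The minimization problem *)

Section cap.
Variables (R : realType) (b : R).
Local Notation mu := (@lebesgue_measure R).
Local Notation s := (Num.sqrt (1 - b ^+ 2)).
Implicit Types (r x : R) (v h : R -> R).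

Definition cap r x := semicircle r x - b * r.

Definition unit_cap_area := acos b - b * s.

Definition unit_area_radius := (Num.sqrt unit_cap_area)^-1.

Hypothesis b01 : 0 < b < 1.

Let b_gt0 : 0 < b. Proof. by case/andP: b01. Qed.

Let b_lt1 : b < 1. Proof. by case/andP: b01. Qed.

Let sqr_s : s ^+ 2 = 1 - b ^+ 2.
Proof. by rewrite sqr_sqrtr// subr_ge0 expr_le1 ?ltW. Qed.

Lemma sqrt1B_sqr_gt0 : 0 < s.
Proof. by rewrite sqrtr_gt0 subr_gt0 expr_lt1 ?ltW. Qed.

Let s_gt0 := sqrt1B_sqr_gt0.

Let s_lt1 : s < 1.
Proof. by rewrite -(@expr_lt1 _ 2) ?ltW// sqr_s gtrBl exprn_gt0. Qed.

(* The unit circular segment of half-angle [a] has area [a - cos a * sin a],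
   which increases with [a]. *)
Lemma unit_cap_area_gt0 : 0 < unit_cap_area.
Proof.
have /andP[b0 b1] := b01.
have a0 : 0 < acos b by apply: acos_gt0; lra.
have api : acos b < pi by apply: acos_ltpi; lra.
pose segment (a : R) := a - cos a * sin a.
have dseg (a : R) : is_derive a 1 segment (2 * sin a ^+ 2).
  apply: is_derive_eq; rewrite /GRing.scale /=.
  by have := cos2Dsin2 a; nra.
have cseg : continuous segment.
  move=> a; apply/differentiable_continuous/derivable1_diffP.
  by have [] := dseg a.
have [c + E] := MVT a0 (fun a _ => dseg a) (continuous_subspaceT cseg).
rewrite in_itv/= => /andP[c0 ca].
have sc : 0 < sin c by apply: sin_gt0_pi; rewrite c0 (lt_trans ca).
move: E; rewrite /segment sin0 mulr0 !subr0 acosK ?sin_acos ?in_itv/=; try lra.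
by rewrite /unit_cap_area => ->; rewrite !mulr_gt0// exprn_gt0.
Qed.

Lemma unit_area_radius_gt0 : 0 < unit_area_radius.
Proof. by rewrite invr_gt0 sqrtr_gt0 unit_cap_area_gt0. Qed.

Lemma unit_cap_areaE : unit_cap_area = (unit_area_radius ^+ 2)^-1.
Proof. by rewrite exprVn invrK sqr_sqrtr// ltW// unit_cap_area_gt0. Qed.

Section radius.
Variable r : R.
Hypothesis r0 : 0 < r.

Lemma chord_gt0 : 0 < s * r.
Proof. exact: mulr_gt0. Qed.

Lemma sqr_chord_lt x : x ^+ 2 <= (s * r) ^+ 2 -> x ^+ 2 < r ^+ 2.
Proof.
move=> /le_lt_trans; apply.
by rewrite exprMn gtr_pMl ?exprn_gt0// expr_lt1 ?ltW.
Qed.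

Lemma itv_chord_sqr_lt x : x \in `[- (s * r), s * r] -> x ^+ 2 < r ^+ 2.
Proof. by move=> /itv_sqr_le /sqr_chord_lt. Qed.

Lemma semicircle_chord x : x ^+ 2 = (s * r) ^+ 2 -> semicircle r x = b * r.
Proof.
move=> xE; rewrite /semicircle xE (_ : r ^+ 2 - _ = (b * r) ^+ 2).
  by rewrite sqrtr_sqr gtr0_norm// mulr_gt0.
by rewrite !exprMn sqr_s; ring.
Qed.

Lemma cap_chord x : x ^+ 2 = (s * r) ^+ 2 -> cap r x = 0.
Proof. by move=> xE; rewrite /cap semicircle_chord// subrr. Qed.

Lemma cap_ge0 x : x \in `[- (s * r), s * r] -> 0 <= cap r x.
Proof.
move=> /itv_sqr_le xp; rewrite subr_ge0 -(@semicircle_chord (s * r))//.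
exact: le_semicircle.
Qed.

Lemma is_derive_cap x : x ^+ 2 < r ^+ 2 ->
  is_derive x 1 (cap r) (semicircle_slope r x).
Proof.
move=> /is_derive_semicircle dy.
by apply: is_derive_eq; rewrite subr0.
Qed.

Lemma contact_angle_cap x : x ^+ 2 = (s * r) ^+ 2 ->
  1 / Num.sqrt (1 + derive1 (cap r) x ^+ 2) = b.
Proof.
move=> xE; have xr : x ^+ 2 < r ^+ 2 by rewrite sqr_chord_lt ?xE.
have dcap := is_derive_cap xr.
rewrite derive1E derive_val sqrt1D_sqr_semicircle_slope// semicircle_chord//.
by field; rewrite !gt_eqF.
Qed.

Lemma W11_cap : W11 (s * r) (cap r) (semicircle_slope r).
Proof.
apply: W11_is_derive => x /itv_chord_sqr_lt xr.
  exact: continuous_semicircle_slope.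
exact: is_derive_cap.
Qed.

Lemma Rintegral_semicircle_chord :
  \int[mu]_(x in `[- (s * r), s * r]) semicircle r x =
  r ^+ 2 * (acos b + b * s).
Proof.
rewrite Rintegral_semicircle ?chord_gt0 ?gtr_pMl// semicircle_chord//.
by rewrite mulfK ?gt_eqF// asin_sqrt1B_sqr ?ltW//; ring.
Qed.

Lemma Rintegral_cap :
  \int[mu]_(x in `[- (s * r), s * r]) cap r x = r ^+ 2 * unit_cap_area.
Proof.
have pp : - (s * r) <= s * r by rewrite ge0_cp// ltW// chord_gt0.
rewrite (RintegralB _ (integrable_semicircle _ _ _)
                      (integrable_itv_cst _ _ (b * r)))//.
by rewrite Rintegral_semicircle_chord Rintegral_itv_cst// /unit_cap_area; ring.
Qed.

Lemma Jfun_calibration v h : W11 (s * r) v h ->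
    v (s * r) = 0 -> v (- (s * r)) = 0 ->
  Jfun b (s * r) h = (r * unit_cap_area +
    r^-1 * \int[mu]_(x in `[- (s * r), s * r]) v x +
    \int[mu]_(x in `[- (s * r), s * r]) calibration_gap r x (h x))%:E.
Proof.
move=> W vp vNp; have [hi _] := W; set I := `[- (s * r), s * r].
have pp : - (s * r) <= s * r by rewrite ge0_cp// ltW// chord_gt0.
have yi := integrable_semicircle r (- (s * r)) (s * r).
have xhi := integrable_itv_mul_id hi.
have bi := integrable_itv_cst (- (s * r)) (s * r) b.
have gapi := integrable_calibration_gap r hi.
have yxhi : mu.-integrable [set` I]
    (EFin \o (fun x => semicircle r x - x * h x)).
  exact: integrable_EFinB.
have ryxhi : mu.-integrable [set` I]
    (EFin \o (fun x => r^-1 * (semicircle r x - x * h x))).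
  exact: integrable_EFinZl.
have mainI : mu.-integrable [set` I]
    (EFin \o (fun x => r^-1 * (semicircle r x - x * h x) - b)).
  exact: integrable_EFinB.
have Ji : mu.-integrable [set` I]
    (EFin \o (fun x => Num.sqrt (1 + h x ^+ 2) - b)).
  by apply: integrable_EFinB => //; exact: integrable_itv_sqrt1D_sqr.
rewrite /Jfun -EFin_Rintegral//; congr EFin.
transitivity (\int[mu]_(x in [set` I])
    ((r^-1 * (semicircle r x - x * h x) - b) + calibration_gap r x (h x))).
  by apply: eq_Rintegral => x _; rewrite /calibration_gap; ring.
rewrite RintegralD// (RintegralB _ ryxhi bi)// RintegralZl// RintegralB//.
rewrite Rintegral_semicircle_chord Rintegral_itv_cst//.
rewrite (W11_integration_by_parts (ltW chord_gt0) W) vp vNp.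
by rewrite /unit_cap_area; congr (_ + _); field; rewrite gt_eqF.
Qed.

End radius.

Definition radius_gap r :=
  (r - unit_area_radius) ^+ 2 / (r * unit_area_radius ^+ 2).

Lemma radius_gap_ge0 r : 0 < r -> 0 <= radius_gap r.
Proof. by move=> r0; rewrite divr_ge0 ?sqr_ge0// mulr_ge0 ?sqr_ge0// ltW. Qed.

Lemma radius_gap_eq0 r : 0 < r -> (radius_gap r == 0) = (r == unit_area_radius).
Proof.
move=> r0; rewrite /radius_gap mulf_eq0 sqrf_eq0 subr_eq0.
rewrite invr_eq0 mulf_eq0 sqrf_eq0 (gt_eqF r0) (gt_eqF unit_area_radius_gt0).
by rewrite !orbF.
Qed.

Lemma radius_gapE r : 0 < r ->
  r * unit_cap_area + r^-1 = 2 / unit_area_radius + radius_gap r.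
Proof.
move=> r0; have R0 := unit_area_radius_gt0.
by rewrite /radius_gap unit_cap_areaE; field; rewrite !gt_eqF.
Qed.

End cap.

Section minimality.
Variables (R : realType) (b : R).
Local Notation mu := (@lebesgue_measure R).
Local Notation s := (Num.sqrt (1 - b ^+ 2)).
Local Notation rho := (unit_area_radius b).
Implicit Types (r p : R) (u v h : R -> R).

Hypothesis b01 : 0 < b < 1.

Let rho_gt0 := unit_area_radius_gt0 b01.

Let mul_s_divK p : s * (p / s) = p.
Proof. by rewrite mulrC divfK// gt_eqF// sqrt1B_sqr_gt0. Qed.

Lemma admissible_radius_gt0 r v h : admissible (s * r) v h -> 0 < r.
Proof. by case; rewrite pmulr_rgt0// sqrt1B_sqr_gt0. Qed.

Lemma admissible_cap : admissible (s * rho) (cap b rho) (semicircle_slope rho).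
Proof.
have p0 := chord_gt0 b01 rho_gt0; have Wcap := W11_cap b01 rho_gt0.
have capi := W11_integrable (ltW p0) Wcap.
split=> //; split=> //; split.
  by move=> x xp; apply: cap_ge0; rewrite ?in_itv.
split; first exact: cap_chord.
split; first by rewrite cap_chord ?sqrrN.
rewrite -EFin_Rintegral// Rintegral_cap// unit_cap_areaE//.
by rewrite divff// gt_eqF// exprn_gt0.
Qed.

Lemma Jfun_admissible r v h : admissible (s * r) v h ->
  Jfun b (s * r) h = (2 / rho + radius_gap b r +
    \int[mu]_(x in `[- (s * r), s * r]) calibration_gap r x (h x))%:E.
Proof.
move=> adm; have r0 := admissible_radius_gt0 adm.
have [p0 [W [_ [vp [vNp v1]]]]] := adm.
have vi := W11_integrable (ltW p0) W.
rewrite (Jfun_calibration b01 r0 W)// -radius_gapE//.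
by move: v1; rewrite -EFin_Rintegral// => -[->]; rewrite mulr1.
Qed.

Lemma Rintegral_calibration_gap_ge0 r h : 0 < r ->
  0 <= \int[mu]_(x in `[- (s * r), s * r]) calibration_gap r x (h x).
Proof.
move=> r0; apply: Rintegral_ge0 => x /= xp; apply: calibration_gap_ge0 => //.
exact/ltW/(itv_chord_sqr_lt b01 r0).
Qed.

Lemma Rintegral_calibration_gap_eq0_ae r h : 0 < r ->
    mu.-integrable `[- (s * r), s * r] (EFin \o h) ->
    \int[mu]_(x in `[- (s * r), s * r]) calibration_gap r x (h x) = 0 ->
  ae_eq mu `[- (s * r), s * r]%classic h (semicircle_slope r).
Proof.
move=> r0 hi gap0.
have gap_ge0 x : `[- (s * r), s * r]%classic x ->
    0 <= calibration_gap r x (h x).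
  by move=> /(itv_chord_sqr_lt b01 r0)/ltW; exact: calibration_gap_ge0.
have := ge0_Rintegral_eq0_ae _ (integrable_calibration_gap r hi) gap_ge0 gap0.
move=> /(_ (measurable_itv _)).
apply: filterS => x + xp => /(_ xp).
by move/(calibration_gap_eq0 r0 (itv_chord_sqr_lt b01 r0 xp)).
Qed.

Lemma Jfun_cap : Jfun b (s * rho) (semicircle_slope rho) = (2 / rho)%:E.
Proof.
rewrite (Jfun_admissible admissible_cap); congr EFin.
have /eqP -> : radius_gap b rho == 0 by rewrite radius_gap_eq0.
rewrite (@eq_Rintegral _ _ _ _ _ (cst 0)) ?Rintegral_cst ?mul0r ?addr0// => x.
rewrite inE => xp; apply: calibration_gap_slope => //.
exact: (itv_chord_sqr_lt b01 rho_gt0).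
Qed.

Lemma Jfun_ge_cap r v h : admissible (s * r) v h ->
  ((2 / rho)%:E <= Jfun b (s * r) h)%E.
Proof.
move=> adm; have r0 := admissible_radius_gt0 adm.
rewrite (Jfun_admissible adm) lee_fin -addrA lerDl.
by rewrite addr_ge0 ?radius_gap_ge0 ?Rintegral_calibration_gap_ge0.
Qed.

Lemma Jfun_le_cap_eq r v h : admissible (s * r) v h ->
    (Jfun b (s * r) h <= (2 / rho)%:E)%E ->
  r = rho /\ \int[mu]_(x in `[- (s * r), s * r]) calibration_gap r x (h x) = 0.
Proof.
move=> adm; have r0 := admissible_radius_gt0 adm.
have rgap := radius_gap_ge0 b r0.
have cgap := Rintegral_calibration_gap_ge0 h r0.
rewrite (Jfun_admissible adm) lee_fin -addrA gerDl => gaps.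
split; last by lra.
by apply/eqP; rewrite -(radius_gap_eq0 b01 r0); apply/eqP; lra.
Qed.

Lemma minimizer_cap : minimizer b (s * rho) (cap b rho).
Proof.
exists (semicircle_slope rho); split; first exact: admissible_cap.
by move=> q v h; rewrite Jfun_cap -(mul_s_divK q); exact: Jfun_ge_cap.
Qed.

Lemma minimizer_eq_cap p u : minimizer b p u ->
  p = s * rho /\ forall x, - p <= x <= p -> u x = cap b rho x.
Proof.
move=> [h [adm /(_ _ _ _ admissible_cap)]]; rewrite Jfun_cap.
move: adm; rewrite -(mul_s_divK p); move: (p / s) => r adm.
move=> /(Jfun_le_cap_eq adm)[rE]; move: adm; rewrite rE => adm gap0.
have [_ [W [_ [_ [uNp _]]]]] := adm.
split=> // x xp.
apply: (W11_eq_ae W (W11_cap b01 rho_gt0)); last by rewrite in_itv.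
- by rewrite uNp cap_chord ?sqrrN.
- by case: W => hi _; exact: Rintegral_calibration_gap_eq0_ae.
Qed.

End minimality.

Unset Implicit Arguments.

Theorem mainTheorem5 (R : realType) (beta : R) :
  0 < beta < 1 ->
  let Rr : R := (Num.sqrt (acos beta - beta * Num.sqrt (1 - beta ^+ 2)))^-1 in
  let p0 : R := Num.sqrt (1 - beta ^+ 2) * Rr in
  let u0 : R -> R := fun x => Num.sqrt (Rr ^+ 2 - x ^+ 2) - beta * Rr in
  [/\ minimizer beta p0 u0,
      (forall p u, minimizer beta p u ->
         p = p0 /\ forall x, -p <= x <= p -> u x = u0 x),
      (forall (n : nat) x, -p0 <= x <= p0 -> derivable (derive1n n u0) x 1),
      1 / Num.sqrt (1 + (derive1 u0 p0) ^+ 2) = beta &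
      1 / Num.sqrt (1 + (derive1 u0 (-p0)) ^+ 2) = beta].
Proof.
move=> b01 Rr p0 u0; have Rr0 := unit_area_radius_gt0 b01.
split.
- exact: minimizer_cap.
- by move=> p u; exact: minimizer_eq_cap.
- move=> n x xp; apply: derivable_derive1n_semicircleB.
  by apply: (itv_chord_sqr_lt b01 Rr0); rewrite in_itv.
- exact: contact_angle_cap.
- by apply: contact_angle_cap; rewrite ?sqrrN.
Qed.
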